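(* For every level $\ell\in\{1,2,3\}$ and all sets $\Gamma,\Delta$ of propositional formulas, $$\mathsf{G}_{\mathbf{DPL}}\vdash \Gamma\Rightarrow^{\ell}\Delta \quad\text{if and only if}\quad \mathsf{G}_{\mathbf{D}}\vdash \Gamma^{\mathcal V}\Rightarrow^{\ell}\Delta^{\mathcal V}.$$
   Context: Propositional formulas are built from propositional variables and $\bot$ using $\land,\lor,\to$; modal formulas additionally use $\Box$. For a set $\Gamma$ of modal formulas, $\Box\Gamma=\{\Box A: A\in\Gamma\}$. Visser's Gödel translation $(\cdot)^{\mathcal V}$ from propositional to modal formulas: $p^{\mathcal V}=p\land\Box p$ for variables $p$; $\bot^{\mathcal V}=\bot$; $(A\land B)^{\mathcal V}=A^{\mathcal V}\land B^{\mathcal V}$; $(A\lor B)^{\mathcal V}=A^{\mathcal V}\lor B^{\mathcal V}$; $(A\to B)^{\mathcal V}=\Box(A^{\mathcal V}\to B^{\mathcal V})$. For a set, $\Gamma^{\mathcal V}=\{A^{\mathcal V}:A\in\Gamma\}$. A sequent $\Gamma\Rightarrow^{\ell}\Delta$ of level $\ell\in\{1,2,3\}$ consists of two sets $\Gamma,\Delta$ of formulas; commas denote union of sets and $A,\Gamma$ means $\{A\}\cup\Gamma$ (so contraction is built in). $\mathsf G\vdash S$ means that $S$ is derivable in $\mathsf G$. Rules are written ''premises / conclusion''; $\Gamma,\Delta,\Sigma$ are arbitrary sets of formulas and $A,B$ arbitrary formulas of the relevant language. Common rules, for each $\ell\in\{1,2,3\}$: - axioms $p\Rightarrow^{\ell}p$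 ($p$ a propositional variable) and $\bot\Rightarrow^{\ell}$ (empty succedent); - weakening: $\Gamma\Rightarrow^{\ell}\Delta$ / $A,\Gamma\Rightarrow^{\ell}\Delta$, and $\Gamma\Rightarrow^{\ell}\Delta$ / $\Gamma\Rightarrow^{\ell}\Delta,A$; - $A,B,\Gamma\Rightarrow^{\ell}\Delta$ / $A\land B,\Gamma\Rightarrow^{\ell}\Delta$; - $\Gamma\Rightarrow^{\ell}\Delta,A$ and $\Gamma\Rightarrow^{\ell}\Delta,B$ / $\Gamma\Rightarrow^{\ell}\Delta,A\land B$; - $A,\Gamma\Rightarrow^{\ell}\Delta$ and $B,\Gamma\Rightarrow^{\ell}\Delta$ / $A\lor B,\Gamma\Rightarrow^{\ell}\Delta$; - $\Gamma\Rightarrow^{\ell}\Delta,A,B$ / $\Gamma\Rightarrow^{\ell}\Delta,A\lor B$; - lift from level 1 to 2: $\Gamma\Rightarrow^{1}\Delta$ / $\Gamma\Rightarrow^{2}\Delta$. $\mathsf{G}_{\mathbf D}$ (on modal formulas) has the common rules and: - for $\ell\in\{1,2,3\}$: $\Gamma\Rightarrow^{\ell}\Delta,A$ and $B,\Gamma\Rightarrow^{\ell}\Delta$ / $A\to B,\Gamma\Rightarrow^{\ell}\Delta$; - for $\ell\in\{1,2,3\}$: $A,\Gamma\Rightarrow^{\ell}\Delta,B$ / $\Gamma\Rightarrow^{\ell}\Delta,A\to B$; - $\Box\Gamma,\Gamma,\Box A\Rightarrow^{1}A$ / $\Box\Gamma\Rightarrow^{1}\Box A$; - $A,\Gamma\Rightarrow^{2}\Delta$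 / $\Box A,\Gamma\Rightarrow^{2}\Delta$; - lift from level 2 to 3: $\Box\Gamma\Rightarrow^{2}\Box\Delta$ / $\Box\Gamma\Rightarrow^{3}\Box\Delta$. $\mathsf{G}_{\mathbf{DPL}}$ (on propositional formulas) has the common rules and: - at level 2 only: $\Gamma\Rightarrow^{2}\Delta,A$ and $B,\Gamma\Rightarrow^{2}\Delta$ / $A\to B,\Gamma\Rightarrow^{2}\Delta$; - at level 1 only, for every $k\ge 0$ and formulas $C_0,\dots,C_{k-1},D_0,\dots,D_{k-1}$, the rule with the $2^k$ premises $\Delta_i,\Sigma,A\to B,A\Rightarrow^{1}B,\Gamma_i$ ($0\le i<2^k$) and conclusion $\Sigma,\{C_j\to D_j:0\le j<k\}\Rightarrow^{1}A\to B$, where $\Delta_i=\{D_j:\text{the }j\text{-th binary digit of } i \text{ is }1\}$ and $\Gamma_i=\{C_j:\text{the }j\text{-th binary digit of } i\text{ is }0\}$, $0\le j<k$ (digit $j$ has weight $2^j$); - lift from level 2 to 3: $\{A_i\to B_i:0\le i<n\},\Phi\Rightarrow^{2}\{C_j\to D_j:0\le j<m\}$ / $\{A_i\to B_i:0\le i<n\},\Phi\Rightarrow^{3}\{C_j\to D_j:0\le j<m\}$, for $n,m\ge0$, arbitrary formulas $A_i,B_i,C_j,D_j$, and $\Phi$ a set of propositional variables. Neither calculus contains a cut rule. *)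

(* Defs.v *)
From mathcomp Require Import all_boot.
From mathcomp Require Import boolp classical_sets.

Set Implicit Arguments.
Unset Strict Implicit.
Unset Printing Implicit Defensive.

Local Open Scope classical_set_scope.

Definition var := nat.

Inductive pform : Type :=
| PVar of var
| PBot
| PAnd of pform & pform
| POr of pform & pform
| PImp of pform & pform.

Inductive mform : Type :=
| MVar of var
| MBot
| MAnd of mform & mform
| MOr of mform & mform
| MImp of mform & mform
| Box of mform.

Fixpoint visser (A : pform) : mform :=
  match A with
  | PVar p => MAnd (MVar p) (Box (MVar p))
  | PBot => MBot
  | PAnd A B => MAnd (visser A) (visser B)
  | POr A B => MOr (visser A) (visser B)
  | PImp A B => Box (MImp (visser A) (visser B))
  end.

Inductive level : Type := L1 | L2 | L3.

(* [GD l Gamma Delta] and [GDPL l Gamma Delta] say that the sequent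
   Gamma =>^l Delta is derivable.  Sides of a sequent are arbitrary
   (not necessarily finite) sets, compared extensionally. *)

Inductive GD : level -> set mform -> set mform -> Prop :=
| GD_ax l p : GD l [set MVar p] [set MVar p]
| GD_bot l : GD l [set MBot] set0
| GD_weakL l A Gamma Delta :
    GD l Gamma Delta -> GD l (A |` Gamma) Delta
| GD_weakR l A Gamma Delta :
    GD l Gamma Delta -> GD l Gamma (Delta `|` [set A])
| GD_andL l A B Gamma Delta :
    GD l ([set A; B] `|` Gamma) Delta -> GD l (MAnd A B |` Gamma) Delta
| GD_andR l A B Gamma Delta :
    GD l Gamma (Delta `|` [set A]) -> GD l Gamma (Delta `|` [set B]) ->
    GD l Gamma (Delta `|` [set MAnd A B])
| GD_orL l A B Gamma Delta :
    GD l (A |` Gamma) Delta -> GD l (B |` Gamma) Delta ->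
    GD l (MOr A B |` Gamma) Delta
| GD_orR l A B Gamma Delta :
    GD l Gamma (Delta `|` [set A; B]) -> GD l Gamma (Delta `|` [set MOr A B])
| GD_lift12 Gamma Delta :
    GD L1 Gamma Delta -> GD L2 Gamma Delta
| GD_impL l A B Gamma Delta :
    GD l Gamma (Delta `|` [set A]) -> GD l (B |` Gamma) Delta ->
    GD l (MImp A B |` Gamma) Delta
| GD_impR l A B Gamma Delta :
    GD l (A |` Gamma) (Delta `|` [set B]) ->
    GD l Gamma (Delta `|` [set MImp A B])
| GD_box A Gamma :
    GD L1 (Box @` Gamma `|` Gamma `|` [set Box A]) [set A] ->
    GD L1 (Box @` Gamma) [set Box A]
| GD_refl A Gamma Delta :
    GD L2 (A |` Gamma) Delta -> GD L2 (Box A |` Gamma) Delta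
| GD_lift23 Gamma Delta :
    GD L2 (Box @` Gamma) (Box @` Delta) ->
    GD L3 (Box @` Gamma) (Box @` Delta).

Definition digit (i j : nat) : bool := odd (i %/ 2 ^ j).

Inductive GDPL : level -> set pform -> set pform -> Prop :=
| GDPL_ax l p : GDPL l [set PVar p] [set PVar p]
| GDPL_bot l : GDPL l [set PBot] set0
| GDPL_weakL l A Gamma Delta :
    GDPL l Gamma Delta -> GDPL l (A |` Gamma) Delta
| GDPL_weakR l A Gamma Delta :
    GDPL l Gamma Delta -> GDPL l Gamma (Delta `|` [set A])
| GDPL_andL l A B Gamma Delta :
    GDPL l ([set A; B] `|` Gamma) Delta -> GDPL l (PAnd A B |` Gamma) Delta
| GDPL_andR l A B Gamma Delta :
    GDPL l Gamma (Delta `|` [set A]) -> GDPL l Gamma (Delta `|` [set B]) ->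
    GDPL l Gamma (Delta `|` [set PAnd A B])
| GDPL_orL l A B Gamma Delta :
    GDPL l (A |` Gamma) Delta -> GDPL l (B |` Gamma) Delta ->
    GDPL l (POr A B |` Gamma) Delta
| GDPL_orR l A B Gamma Delta :
    GDPL l Gamma (Delta `|` [set A; B]) ->
    GDPL l Gamma (Delta `|` [set POr A B])
| GDPL_lift12 Gamma Delta :
    GDPL L1 Gamma Delta -> GDPL L2 Gamma Delta
| GDPL_impL A B Gamma Delta :
    GDPL L2 Gamma (Delta `|` [set A]) -> GDPL L2 (B |` Gamma) Delta ->
    GDPL L2 (PImp A B |` Gamma) Delta
| GDPL_imp (k : nat) (C D : 'I_k -> pform) (A B : pform)
    (Sigma : set pform) :
    (forall i : nat, (i < 2 ^ k)%N ->
       GDPL L1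
         ([set D j | j in [set j : 'I_k | digit i j]] `|` Sigma
            `|` [set PImp A B; A])
         (B |` [set C j | j in [set j : 'I_k | ~~ digit i j]])) ->
    GDPL L1 (Sigma `|` [set PImp (C j) (D j) | j in [set: 'I_k]])
            [set PImp A B]
| GDPL_lift23 (n m : nat) (A B : 'I_n -> pform) (C D : 'I_m -> pform)
    (Phi : set var) :
    GDPL L2 ([set PImp (A i) (B i) | i in [set: 'I_n]] `|` PVar @` Phi)
            [set PImp (C j) (D j) | j in [set: 'I_m]] ->
    GDPL L3 ([set PImp (A i) (B i) | i in [set: 'I_n]] `|` PVar @` Phi)
            [set PImp (C j) (D j) | j in [set: 'I_m]].

(* Main.v *)
Require Import Defs.
From mathcomp Require Import all_boot.
From mathcomp Require Import boolp classical_sets cardinality.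

(** Both directions are inductions on derivations in which the two sides of
the other calculus are only constrained, not computed. A derivation of a
sequent S => T in one calculus is shown to yield G => D in the other for all
finite G, D that express S, T in a suitable sense. Such G and D may already
contain the outcome of decomposing a formula, and then the induction hypothesis
for one premise is all that its rule requires. This replaces both the inversion
lemmas and the cuts of a rule-by-rule simulation.

From DPL to D ([GDPL_GD_saturated]). The formulas A^V are persistent: A^V
entails []A^V in level 1. The intuitionistic implication rule keeps its context
Sigma across the modal step, whereas the box rule of D only keeps boxed
formulas, and bridging the two would normally take persistence and a cut.
Instead, G is required to be [saturates]-closed: it contains p and []p for each
atom p of S, the components of conjunctions, one component of each disjunction,
and the boxed translation of each implication. All the information in a
saturated set sits in, or under, its boxed formulas, so saturation survives the
step from G to []U,U with U = {X | []X in G} ([saturates_unbox]). The rules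
for conjunction and disjunction let one saturate any antecedent from the root
upwards ([GD_saturate]). The 2^k premises of the implication rule are the
leaves of the tree obtained by applying the left implication rule to k
implications in turn ([GD_branch] and [digit_surj]).

From D to DPL ([GD_GDPL_realized]). A derivation of a translated sequent
contains, besides formulas A^V, only p, []p and A^V -> B^V. They are read in
the propositional language as if the valuation of atoms were persistent: p as
p; []p as p or as T -> p; and A^V -> B^V on the left by having B on the left or
A on the right, on the right by having both A on the left and B on the right
([realizedL], [realizedR]). Leaving the reading of []p on the left open is
essential: p /\ []p is translated back to p, so []p must be readable as p,
while the diagonal formula []p of the box rule is not available as p and must
be read as T -> p. The box rule becomes the implication rule applied to all
implications of the antecedent at once; each of the 2^k premises makes one of
the two choices for every C -> D under the box. In the lift from level 2 to
level 3, a boxed antecedent is realized by implications and atoms only, which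
is the form that the corresponding rule of DPL asks for.

Derivable sequents are finite in both calculi, which allows weakening to
arbitrary finite supersets. *)

Set Implicit Arguments.
Unset Strict Implicit.
Unset Printing Implicit Defensive.

Local Open Scope classical_set_scope.

(** * Finite sets *)

Lemma finite_enum (T : Type) (A : set T) :
  finite_set A -> exists n (f : 'I_n -> T), A = [set f i | i in [set: 'I_n]].
Proof.
elim/Pchoice: T => T in A *; case/finite_seqP=> s ->.
exists (size s), (tnth (in_tuple s)).
apply/seteqP; split=> [x /=|_ [i _ <-]] /=.
  by case/(tnthP (in_tuple s))=> i ->; exists i.
exact: mem_tnth.
Qed.

Lemma finite_ord_image (T : Type) n (f : 'I_n -> T) (P : set 'I_n) :
  finite_set [set f i | i in P].
Proof. by apply: finite_image; apply: sub_finite_set (@subsetT _ P) _. Qed.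

(** Induction from A up to a finite superset B, one element at a time: this is
how a rule that adds a single formula is iterated. *)
Lemma finite_extend (T : Type) (P : set T -> Prop) (A B : set T) :
    (forall a X, P X -> P (a |` X)) ->
  finite_set B -> A `<=` B -> P A -> P B.
Proof.
move=> addP; elim/Pchoice: T => T in P A B addP *; case/finite_seqP=> s -> AB PA.
have -> : [set` s] = [set` s] `|` A by rewrite setUC setUidr.
elim: s {AB} => [|a s IHs]; first by rewrite set_nil set0U.
have -> : [set` a :: s] = a |` [set` s].
  apply/seteqP; split=> x /=.
    by rewrite inE => /predU1P.
  by move/predU1P; rewrite inE.
by rewrite -setUA; apply: addP.
Qed.

Lemma finite_imps (G : set pform) :
  finite_set G -> finite_set [set X : pform * pform | G (PImp X.1 X.2)].
Proof.
by apply: finite_preimage => -[A B] [C D] _ _ /= [-> ->].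
Qed.

Lemma visser_inj : injective visser.
Proof.
elim=> [p||A IHA B IHB|A IHA B IHB|A IHA B IHB] [q||C D|C D|C D] //=.
all: try by [case; case: C | case; case: A {IHA}].
- by case=> ->.
- by case=> eA eB; rewrite (IHA _ eA) (IHB _ eB).
- by case=> eA eB; rewrite (IHA _ eA) (IHB _ eB).
- by case=> eA eB; rewrite (IHA _ eA) (IHB _ eB).
Qed.

Lemma finite_visser (G : set pform) : finite_set (visser @` G) -> finite_set G.
Proof.
move=> /(finite_preimage (f:=visser)) fG.
apply: sub_finite_set (fG _) => [A GA|A B _ _ /visser_inj //]; by exists A.
Qed.

Ltac finite := rewrite /= ?finite_setU; repeat split; try done;
  try exact: finite_set1; try exact: finite_set2; try exact: finite_set0;
  try exact: finite_ord_image; try (apply: finite_image; done).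

(** * Finiteness and weakening *)

Ltac split_finite :=
  repeat match goal with
  | H : _ /\ _ |- _ => case: H => *
  | H : finite_set (_ `|` _) |- _ => rewrite finite_setU in H
  end.

Lemma GD_finite l G D : GD l G D -> finite_set G /\ finite_set D.
Proof.
elim=> {l G D} *; split_finite; finite.
Qed.

Lemma GDPL_finite l G D : GDPL l G D -> finite_set G /\ finite_set D.
Proof.
elim=> {l G D}; try by move=> *; split_finite; finite.
move=> k C D A B S _ /(_ 0); rewrite expn_gt0 /= => /(_ isT) [].
by rewrite !finite_setU => -[[_ fS] _] _; split; finite.
Qed.

Lemma GD_weak l G D G' D' :
    finite_set G' -> finite_set D' -> G `<=` G' -> D `<=` D' ->
  GD l G D -> GD l G' D'.
Proof.
move=> fG' fD' GG' DD' GD0.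
apply: (@finite_extend _ (fun X => GD l X D') _ _ _ fG' GG') => [a X|].
  exact: GD_weakL.
apply: (@finite_extend _ (fun X => GD l G X) _ _ _ fD' DD') => // a X.
by rewrite [a |` _]setUC; exact: GD_weakR.
Qed.

Lemma GDPL_weak l G D G' D' :
    finite_set G' -> finite_set D' -> G `<=` G' -> D `<=` D' ->
  GDPL l G D -> GDPL l G' D'.
Proof.
move=> fG' fD' GG' DD' GD0.
apply: (@finite_extend _ (fun X => GDPL l X D') _ _ _ fG' GG') => [a X|].
  exact: GDPL_weakL.
apply: (@finite_extend _ (fun X => GDPL l G X) _ _ _ fD' DD') => // a X.
by rewrite [a |` _]setUC; exact: GDPL_weakR.
Qed.

(** Contraction is built into sets, so a rule may be applied upwards to a
formula that is already present and remains so in the premises. *)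
Lemma absorbL (T : Type) (x : T) (A : set T) : A x -> x |` A = A.
Proof. by move=> Ax; apply: setUidr => _ ->. Qed.

Lemma absorbR (T : Type) (x : T) (A : set T) : A x -> A `|` [set x] = A.
Proof. by move=> Ax; rewrite setUC absorbL. Qed.

(** * From DPL to D *)

(** A syntactic forcing relation. The clause for PBot is False because an
antecedent containing MBot is an axiom, so only the others need saturating. *)
Fixpoint saturates (G : set mform) (A : pform) : Prop :=
  match A with
  | PVar p => G (MVar p) /\ G (Box (MVar p))
  | PBot => False
  | PAnd A B => saturates G A /\ saturates G B
  | POr A B => saturates G A \/ saturates G B
  | PImp A B => G (Box (MImp (visser A) (visser B)))
  end.

Lemma saturates_sub (G G' : set mform) A :
  G `<=` G' -> saturates G A -> saturates G' A.
Proof.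
by move=> GG'; elim: A => //= [p|A IHA B IHB|A IHA B IHB|A IHA B IHB];
  intuition.
Qed.

(** Root-first decomposition of a translated antecedent: every case is a left
rule of D or the axiom for MBot, and the translation of an implication already
is its own saturation. *)
Lemma GD_saturate l A D G :
    finite_set G -> finite_set D ->
    (forall G', finite_set G' -> G `<=` G' -> saturates G' A -> GD l G' D) ->
  GD l (visser A |` G) D.
Proof.
move=> fG fD; elim: A G fG => [p||A IHA B IHB|A IHA B IHB|A IHA B IHB] G fG H /=.
- apply: GD_andL; apply: H; first finite.
    exact: subsetUr.
  by split; left; [left|right].
- by apply: GD_weak (GD_bot l); [finite| |apply: subsetUl|].
- apply: GD_andL; rewrite -setUA; apply: IHA => [|G1 fG1 sG1 G1A]; first finite.
  have G1B : G1 (visser B) by apply: sG1; left.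
  rewrite -(absorbL G1B); apply: IHB => // G2 fG2 sG2 G2B.
  apply: H => // [x Gx|]; first by apply/sG2/sG1; right.
  by split=> //; apply: saturates_sub G1A.
- by apply: GD_orL; [apply: IHA|apply: IHB] => // G' fG' sG' G'S;
    apply: H => //; [left|right].
- by apply: H; [finite|apply: subsetUr|left].
Qed.

Lemma GD_saturate_set l (S : set pform) D G :
    finite_set S -> finite_set G -> finite_set D ->
    (forall G', finite_set G' -> G `<=` G' -> S `<=` saturates G' ->
       GD l G' D) ->
  GD l (visser @` S `|` G) D.
Proof.
move=> fS fG fD; move: G fG.
apply: (@finite_extend _ (fun S : set pform => forall G, finite_set G ->
  (forall G', finite_set G' -> G `<=` G' -> S `<=` saturates G' ->
     GD l G' D) -> GD l (visser @` S `|` G) D) set0 _ _ fS) => //.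
- move=> A {fS}S IHS G fG H; rewrite image_setU image_set1 -setUA.
  rewrite setUCA; apply: IHS => [|G1 fG1 sG1 G1S]; first finite.
  have G1A : G1 (visser A) by apply: sG1; left.
  rewrite -(absorbL G1A); apply: GD_saturate => // G2 fG2 sG2 G2A.
  apply: H => // [x Gx|B [->//|SB]]; first by apply/sG2/sG1; right.
  exact: saturates_sub (G1S _ SB).
- by move=> G fG H; rewrite image_set0 set0U; apply: H.
Qed.

(** Every choice of branches is the binary expansion of the number of some
premise of the implication rule. *)
Lemma digit_surj (f : nat -> bool) k :
  exists2 i, i < 2 ^ k & forall j, j < k -> digit i j = f j.
Proof.
elim: k f => [|k IHk] f; first by exists 0.
have [i lt_i iP] := IHk (f \o succn).
exists (f 0 + i.*2) => [|[|j] ltj].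
- rewrite expnS mul2n; case: (f 0); last by rewrite ltn_double.
  by rewrite add1n ltn_Sdouble.
- by rewrite /digit expn0 divn1 oddD odd_double addbF oddb.
- by have /= <- := iP j ltj; rewrite /digit expnS divnMA divn2 half_bit_double.
Qed.

(** Applying the left implication rule to all the implications of s: at each
leaf, either D j has been added on the left, and can be saturated, or C j has
been added on the right. *)
Lemma GD_branch (T : eqType) (C D : T -> pform) (s : seq T) G E :
    finite_set G -> finite_set E ->
    (forall j, j \in s -> G (MImp (visser (C j)) (visser (D j)))) ->
    (forall G' E', finite_set G' -> finite_set E' -> G `<=` G' -> E `<=` E' ->
       (forall j, j \in s -> saturates G' (D j) \/ E' (visser (C j))) ->
       GD L1 G' E') ->
  GD L1 G E.
Proof.
move=> fG fE; elim: s => [|j s IHs] in G E fG fE * => impG H; first exact: H.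
have impGj : G (MImp (visser (C j)) (visser (D j))).
  by apply: impG; rewrite inE eqxx.
have impGs i : i \in s -> G (MImp (visser (C i)) (visser (D i))).
  by move=> si; apply: impG; rewrite inE si orbT.
rewrite -(absorbL impGj); apply: GD_impL.
- apply: IHs => // [|G' E' fG' fE' GG' EE' sE']; first finite.
  apply: H => // [x Ex|i /predU1P[->|/sE'//]]; first by apply: EE'; left.
  by right; apply: EE'; right.
- apply: GD_saturate => // G1 fG1 sG1 G1D.
  apply: IHs => // [i /impGs/sG1//|G' E' fG' fE' GG' EE' sE'].
  apply: H => // [x /sG1/GG'//|i /predU1P[->|/sE'//]].
  by left; apply: saturates_sub G1D.
Qed.

Lemma GD_boxvar l p : GD l [set Box (MVar p)] [set Box (MVar p)].
Proof.
have ax1 : GD L1 [set Box (MVar p)] [set Box (MVar p)].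
  rewrite -[X in GD _ X](image_set1 Box); apply: GD_box; rewrite image_set1.
  by apply: GD_weak (GD_ax _ p); [finite|finite|move=> _ ->; left; right|].
case: l => //; first exact: GD_lift12.
by rewrite -image_set1; apply: GD_lift23; rewrite image_set1; apply: GD_lift12.
Qed.

Definition unbox (G : set mform) : set mform := [set X | G (Box X)].

Lemma finite_unbox (G : set mform) : finite_set G -> finite_set (unbox G).
Proof. by apply: finite_preimage => A B _ _ []. Qed.


Lemma box_unbox G : Box @` unbox G `<=` G.
Proof. by move=> _ [X GX <-]. Qed.

(** Persistence of translated formulas, in the form in which the box rule uses
it: a saturated antecedent loses nothing when it passes below the box. *)
Lemma saturates_unbox G A :
  saturates G A -> saturates (Box @` unbox G `|` unbox G) A.
Proof.
elim: A => //= [p [_ Gp]|A IHA B IHB|A IHA B IHB|A IHA B IHB]; [|intuition..|].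
  by split; [right|left; exists (MVar p)].
by move=> GAB; left; exists (MImp (visser A) (visser B)).
Qed.

Lemma GD_box_unbox A G D : finite_set G -> finite_set D -> D (Box A) ->
  GD L1 (Box @` unbox G `|` unbox G `|` [set Box A]) [set A] -> GD L1 G D.
Proof.
move=> fG fD DA /GD_box; apply: GD_weak => // [|_ ->//].
exact: box_unbox.
Qed.

(** Reflection at level 2, iterated over formulas that stand under a box in G. *)
Lemma GD_refl_unbox (U G : set mform) D : finite_set U -> finite_set G ->
  U `<=` unbox G -> GD L2 (U `|` G) D -> GD L2 G D.
Proof.
move=> fU fG; apply: (@finite_extend _ (fun U : set mform =>
  U `<=` unbox G -> GD L2 (U `|` G) D -> GD L2 G D) set0 _ _ fU) => //.
- move=> A {fU}U IHU sU; rewrite -setUA => /GD_refl.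
  rewrite absorbL; last by right; apply: sU; left.
  by apply: IHU => B UB; apply: sU; right.
- by rewrite set0U.
Qed.

(** The crucial cases are the implication rule, where persistence and branching
combine, and the lift to level 3, where the atoms Phi are expressed by boxed
formulas alone and recovered at level 2 by reflection. *)
Lemma GDPL_GD_saturated l S T : GDPL l S T ->
  forall G D, finite_set G -> finite_set D ->
    S `<=` saturates G -> visser @` T `<=` D -> GD l G D.
Proof.
elim=> {l S T}.
- move=> l p G D fG fD /(_ _ erefl) [Gp Gbp] vD.
  have Dp : D (MAnd (MVar p) (Box (MVar p))) by apply: vD; exists (PVar p).
  rewrite -(absorbR Dp); apply: GD_andR.
    by apply: GD_weak (GD_ax _ p); [|finite|move=> _ ->|right].
  by apply: GD_weak (GD_boxvar _ p); [|finite|move=> _ ->|right].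
- by move=> l G D _ _ /(_ _ erefl).
- by move=> l A S T _ IH G D fG fD sS; apply: IH => // B SB; apply: sS; right.
- move=> l A S T _ IH G D fG fD sS vD; apply: IH => //.
  by apply: subset_trans vD; apply: image_subset; apply: subsetUl.
- move=> l A B S T _ IH G D fG fD sS; apply: IH => // X.
  have [GA GB] : saturates G (PAnd A B) by apply: sS; left.
  by case=> [[->|->]|SX] //; apply: sS; right.
- move=> l A B S T _ IHA _ IHB G D fG fD sS.
  rewrite image_setU image_set1 subUset => -[vD vAB].
  rewrite -(absorbR (vAB _ erefl)); apply: GD_andR; [apply: IHA|apply: IHB] => //;
    by [finite|rewrite image_setU image_set1; apply: setSU].
- move=> l A B S T _ IHA _ IHB G D fG fD sS vD.
  have [GA|GB] : saturates G (POr A B) by apply: sS; left.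
    by apply: IHA => // X [->//|SX]; apply: sS; right.
  by apply: IHB => // X [->//|SX]; apply: sS; right.
- move=> l A B S T _ IH G D fG fD sS.
  rewrite image_setU image_set1 subUset => -[vD vAB].
  rewrite -(absorbR (vAB _ erefl)); apply: GD_orR; apply: IH => //; first finite.
  by rewrite image_setU image_setU !image_set1; apply: setSU.
- by move=> S T _ IH G D fG fD sS vD; apply/GD_lift12/IH.
- move=> A B S T _ IHA _ IHB G D fG fD sS vD.
  have GAB : G (Box (MImp (visser A) (visser B))) by apply: (sS (PImp A B)); left.
  rewrite -(absorbL GAB); apply/GD_refl/GD_impL.
    apply: IHA => //; first finite.
      by move=> X SX; apply: sS; right.
    by rewrite image_setU image_set1; apply: setSU.
  apply: GD_saturate => // G' fG' sG' G'B; apply: IHB => // X [->//|SX].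
  by apply: saturates_sub sG' _; apply: sS; right.
- move=> k C D A B S _ IH G E fG fE sS vE.
  have EAB : E (Box (MImp (visser A) (visser B))).
    by apply: vE; exists (PImp A B).
  apply: (GD_box_unbox fG fE EAB).
  have fU : finite_set (unbox G) by exact: finite_unbox.
  rewrite -[X in GD _ _ X]set0U; apply: GD_impR.
  apply: GD_saturate => [| |G1 fG1 sG1 G1A]; [finite..|].
  apply: (@GD_branch _ C D (enum 'I_k)) => // [|j _|G2 E2 fG2 fE2 sG2 sE2 br].
  + finite.
  + apply: sG1; left; right.
    by apply: (sS (PImp (C j) (D j))); right; exists j.
  (* The leaf reached determines the premise: digit j is 1 exactly when D j is
     saturated; insub makes the number j < k an index of D, and the default
     value fills the digits from k on. *)
  have [i lti iP] := digit_surj (fun j =>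
    if insub j is Some j' then `[< saturates G2 (D j') >] else false) k.
  apply: (IH i lti) => //.
  + move=> X [[[j /= dj <-]|SX]|[->|->]].
    * by move: dj; rewrite iP // valK => /asboolP.
    * apply: saturates_sub (saturates_unbox (sS X _)); last by left.
      by move=> Y GY; apply/sG2/sG1; left.
    * by apply/sG2/sG1; right.
    * exact: saturates_sub G1A.
  + move=> _ [X [->|[j /= dj <-]] <-]; first by apply: sE2; right.
    case: (br j); rewrite ?mem_enum // => satD.
    by move: dj; rewrite iP // valK => /asboolP.
- move=> n m A B C D Phi _ IH G E fG fE sS vE.
  have fU : finite_set (unbox G) by exact: finite_unbox.
  pose E' := [set MImp (visser (C j)) (visser (D j)) | j in [set: 'I_m]].
  have bE' : Box @` E' = visser @` [set PImp (C j) (D j) | j in [set: 'I_m]].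
    by rewrite /E' !image_comp.
  rewrite -bE' in vE.
  have : GD L3 (Box @` unbox G) (Box @` E'); last first.
    by apply: GD_weak => //; apply: box_unbox.
  (* The lift needs boxes only; the atoms in Phi are regained by reflection. *)
  apply: GD_lift23; apply: (@GD_refl_unbox (unbox G)) => //; first finite.
    by move=> X GX; exists X.
  rewrite bE' in vE *; apply: IH => //; [finite|apply: finite_image; finite|].
  by move=> X /sS /saturates_unbox; rewrite setUC.
Qed.

Lemma GDPL_GD l S T : GDPL l S T -> GD l (visser @` S) (visser @` T).
Proof.
move=> ST; have [fS fT] := GDPL_finite ST.
have fvT : finite_set (visser @` T) by finite.
rewrite -[X in GD _ X]setU0.
apply: (GD_saturate_set fS _ fvT) => [|G' fG' _ sS]; first exact: finite_set0.
exact: (GDPL_GD_saturated ST).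
Qed.

(** * From D to DPL *)

Definition PTop := PImp PBot PBot.

(** An implication A^V -> B^V has two readings because the left implication rule
has two premises. The two readings of []p serve different origins: p when []p
stems from p /\ []p, and T -> p when it is the diagonal formula of the box
rule. *)
Inductive realizedL (G D : set pform) : mform -> Prop :=
| RealizedL_var p : G (PVar p) -> realizedL G D (MVar p)
| RealizedL_boxvar p : G (PVar p) -> realizedL G D (Box (MVar p))
| RealizedL_boxtop p : G (PImp PTop (PVar p)) -> realizedL G D (Box (MVar p))
| RealizedL_visser A : G A -> realizedL G D (visser A)
| RealizedL_imp A B :
    G B \/ D A -> realizedL G D (MImp (visser A) (visser B)).

(** For []p only T -> p is accepted in the succedent: the box rule has []p as
its conclusion, and its counterpart derives an implication. *)
Inductive realizedR (G D : set pform) : mform -> Prop :=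
| RealizedR_var p : D (PVar p) -> realizedR G D (MVar p)
| RealizedR_boxtop p : D (PImp PTop (PVar p)) -> realizedR G D (Box (MVar p))
| RealizedR_visser A : D A -> realizedR G D (visser A)
| RealizedR_imp A B : G A -> D B ->
    realizedR G D (MImp (visser A) (visser B)).

Lemma realizedL_sub (G D G' D' : set pform) X :
  G `<=` G' -> D `<=` D' -> realizedL G D X -> realizedL G' D' X.
Proof.
move=> GG' DD'; case=> [p /GG'|p /GG'|p /GG'|A /GG'|A B H].
- exact: RealizedL_var.
- exact: RealizedL_boxvar.
- exact: RealizedL_boxtop.
- exact: RealizedL_visser.
- by apply: RealizedL_imp; case: H => [/GG'|/DD']; [left|right].
Qed.

Lemma realizedR_sub (G D G' D' : set pform) X :
  G `<=` G' -> D `<=` D' -> realizedR G D X -> realizedR G' D' X.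
Proof.
move=> GG' DD'; case=> [p /DD'|p /DD'|A /DD'|A B /GG' ? /DD' ?].
- exact: RealizedR_var.
- exact: RealizedR_boxtop.
- exact: RealizedR_visser.
- exact: RealizedR_imp.
Qed.

Lemma realizedL_setUl U G D X : realizedL G D X -> realizedL (U `|` G) D X.
Proof. by apply: realizedL_sub => // Y; right. Qed.

Lemma realizedL_setUr U G D X : realizedL G D X -> realizedL G (D `|` U) X.
Proof. by apply: realizedL_sub => // Y; left. Qed.

Lemma realizedR_setUl U G D X : realizedR G D X -> realizedR (U `|` G) D X.
Proof. by apply: realizedR_sub => // Y; right. Qed.

Lemma realizedR_setUr U G D X : realizedR G D X -> realizedR G (D `|` U) X.
Proof. by apply: realizedR_sub => // Y; left. Qed.

Lemma realizedL_inv G D X : realizedL G D X ->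
  match X with
  | MVar p => G (PVar p)
  | MBot => G PBot
  | MAnd Y Z =>
      (exists p, [/\ Y = MVar p, Z = Box (MVar p) & G (PVar p)]) \/
      (exists A B, [/\ Y = visser A, Z = visser B & G (PAnd A B)])
  | MOr Y Z => exists A B, [/\ Y = visser A, Z = visser B & G (POr A B)]
  | MImp Y Z => exists A B, [/\ Y = visser A, Z = visser B & G B \/ D A]
  | Box Y =>
      (exists2 p, Y = MVar p & G (PVar p) \/ G (PImp PTop (PVar p))) \/
      (exists A B, Y = MImp (visser A) (visser B) /\ G (PImp A B))
  end.
Proof.
case=> [p Gp|p Gp|p Gp|[p||A B|A B|A B] GA|A B GD] //=.
- by left; exists p; [|left].
- by left; exists p; [|right].
- by left; exists p.
- by right; exists A, B.
- by exists A, B.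
- by right; exists A, B.
- by exists A, B.
Qed.

Lemma realizedR_inv G D X : realizedR G D X ->
  match X with
  | MVar p => D (PVar p)
  | MBot => D PBot
  | MAnd Y Z =>
      (exists p, [/\ Y = MVar p, Z = Box (MVar p) & D (PVar p)]) \/
      (exists A B, [/\ Y = visser A, Z = visser B & D (PAnd A B)])
  | MOr Y Z => exists A B, [/\ Y = visser A, Z = visser B & D (POr A B)]
  | MImp Y Z => exists A B, [/\ Y = visser A, Z = visser B, G A & D B]
  | Box Y =>
      (exists2 p, Y = MVar p & D (PImp PTop (PVar p))) \/
      (exists A B, Y = MImp (visser A) (visser B) /\ D (PImp A B))
  end.
Proof.
case=> [p Dp|p Dp|[p||A B|A B|A B] DA|A B GA DB] //=.
- by left; exists p.
- by left; exists p.
- by right; exists A, B.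
- by exists A, B.
- by right; exists A, B.
- by exists A, B.
Qed.

Lemma GDPL_top l G D : finite_set G -> finite_set D -> D PTop -> GDPL l G D.
Proof.
move=> fG fD DT.
have top1 G' D' : finite_set G' -> finite_set D' -> D' PTop -> GDPL L1 G' D'.
  move=> fG' fD' DT'.
  apply: GDPL_weak (GDPL_imp (k := 0) (C := fun _ => PBot) (D := fun _ => PBot)
    (A := PBot) (B := PBot) (Sigma := set0) _) => // [X [//|[[]//]]|_ -> //|i _].
  by apply: GDPL_weak (GDPL_bot _) => //; [finite|finite|move=> _ ->; right; right].
case: l; [exact: top1|exact/GDPL_lift12/top1|].
apply: GDPL_weak (GDPL_lift23 (n := 0) (m := 1) (A := fun _ => PBot)
  (B := fun _ => PBot) (C := fun _ => PBot) (D := fun _ => PBot) (Phi := set0) _)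
  => // [X [[[]//]|[]//]|_ [_ _ <-] //|].
apply/GDPL_lift12/top1; [|finite|by exists ord0].
by finite; apply: finite_image.
Qed.

Lemma finite_imps_enum (G : set pform) : finite_set G ->
  exists n (C D : 'I_n -> pform),
    [set PImp (C j) (D j) | j in [set: 'I_n]] `<=` G /\
    forall A B, G (PImp A B) -> exists2 j, A = C j & B = D j.
Proof.
move/finite_imps/finite_enum=> [n [f fE]].
have ff j : G (PImp (f j).1 (f j).2).
  suff : [set X : pform * pform | G (PImp X.1 X.2)] (f j) by [].
  by rewrite fE; exists j.
exists n, (fun j => (f j).1), (fun j => (f j).2); split=> [_ [j _ <-] //|A B GAB].
have : [set X : pform * pform | G (PImp X.1 X.2)] (A, B) by [].
by rewrite fE => -[j _ fj]; exists j; rewrite fj.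
Qed.

(** Whether X is an atom or an implication, []X on the right is realized by an
implication A -> B, and the premise of the implication rule that derives A -> B
realizes both X on the right and the diagonal []X on the left. *)
Lemma realizedR_box G D X : realizedR G D (Box X) ->
  exists A B, D (PImp A B) /\
    (forall G' D', G' A -> G' (PImp A B) -> D' B ->
       realizedR G' D' X /\ realizedL G' D' (Box X)).
Proof.
case/realizedR_inv=> [[p -> Dp]|[A [B [-> DAB]]]].
  exists PTop, (PVar p); split=> // G' D' _ G'p D'p.
  by split; [apply: RealizedR_var|apply: RealizedL_boxtop].
exists A, B; split=> // G' D' G'A G'AB D'B.
by split; [apply: RealizedR_imp|apply: (RealizedL_visser _ (A := PImp A B))].
Qed.

(** Likewise for []X on the left: either X is available at once, or splitting
some A -> B makes X available in both branches, except in the branch with T on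
the right, which is derivable by itself. *)
Lemma realizedL_box G D X : realizedL G D (Box X) ->
  (forall G' D', G `<=` G' -> realizedL G' D' X) \/
  (exists A B, G (PImp A B) /\
     (forall G' D', G' B \/ (D' A /\ ~ D' PTop) -> realizedL G' D' X)).
Proof.
case/realizedL_inv=> [[p -> [Gp|Gp]]|[A [B [-> GAB]]]].
- by left=> G' D' GG'; apply/RealizedL_var/GG'.
- right; exists PTop, (PVar p); split=> // G' D' [G'p|[]//].
  exact: RealizedL_var.
- right; exists A, B; split=> // G' D' H; apply: RealizedL_imp.
  by case: H => [|[]]; [left|right].
Qed.

(** The propositional rules that D applies to p /\ []p and to A^V -> B^V leave
G and D unchanged, since the realization already records their outcome. *)
Lemma GD_GDPL_realized l S T : GD l S T ->
  forall G D, finite_set G -> finite_set D ->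
    S `<=` realizedL G D -> T `<=` realizedR G D -> GDPL l G D.
Proof.
elim=> {l S T}.
- move=> l p G D fG fD /(_ _ erefl)/realizedL_inv Gp /(_ _ erefl)/realizedR_inv Dp.
  by apply: GDPL_weak (GDPL_ax _ p) => // x ->.
- move=> l G D fG fD /(_ _ erefl)/realizedL_inv Gbot _.
  by apply: GDPL_weak (GDPL_bot _) => // _ ->.
- by move=> l A S T _ IH G D fG fD sS; apply: IH => // X SX; apply: sS; right.
- by move=> l A S T _ IH G D fG fD sS sT; apply: IH => // X TX; apply: sT; left.
- move=> l Y Z S T _ IH G D fG fD sS sT.
  have /realizedL_inv [[p [eY eZ Gp]]|[A [B [eY eZ GAB]]]] :
    realizedL G D (MAnd Y Z) by apply: sS; left.
    apply: IH => // X [[->|->]|SX]; last by apply: sS; right.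
      by rewrite eY; apply: RealizedL_var.
    by rewrite eZ; apply: RealizedL_boxvar.
  rewrite -(absorbL GAB); apply: GDPL_andL; apply: IH => // [|X|X /sT].
  + finite.
  + case=> [[->|->]|SX].
    * by rewrite eY; apply: RealizedL_visser; left; left.
    * by rewrite eZ; apply: RealizedL_visser; left; right.
    * by apply/realizedL_setUl/sS; right.
  + exact: realizedR_setUl.
- move=> l Y Z S T _ IHY _ IHZ G D fG fD sS sT.
  have /realizedR_inv [[p [eY eZ Dp]]|[A [B [eY eZ DAB]]]] :
    realizedR G D (MAnd Y Z) by apply: sT; right.
    apply: IHY => // X [TX|->]; first by apply: sT; left.
    by rewrite eY; apply: RealizedR_var.
  rewrite -(absorbR DAB).
  by apply: GDPL_andR; [apply: IHY|apply: IHZ] => // [|X /sS|X [TX|->]|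
      |X /sS|X [TX|->]]; first [by finite
    | exact: realizedL_setUr
    | by rewrite ?eY ?eZ; apply: RealizedR_visser; right
    | by apply/realizedR_setUr/sT; left].
- move=> l Y Z S T _ IHY _ IHZ G D fG fD sS sT.
  have /realizedL_inv [A [B [eY eZ GAB]]] :
    realizedL G D (MOr Y Z) by apply: sS; left.
  rewrite -(absorbL GAB).
  by apply: GDPL_orL; [apply: IHY|apply: IHZ] => // [|X [->|SX]|X /sT|
      |X [->|SX]|X /sT]; first [by finite
    | by rewrite ?eY ?eZ; apply: RealizedL_visser; left
    | by apply/realizedL_setUl/sS; right
    | exact: realizedR_setUl].
- move=> l Y Z S T _ IH G D fG fD sS sT.
  have /realizedR_inv [A [B [eY eZ DAB]]] :
    realizedR G D (MOr Y Z) by apply: sT; right.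
  rewrite -(absorbR DAB); apply: GDPL_orR.
  apply: IH => // [|X /sS|X [TX|[->|->]]].
  + finite.
  + exact: realizedL_setUr.
  + by apply/realizedR_setUr/sT; left.
  + by rewrite eY; apply: RealizedR_visser; right; left.
  + by rewrite eZ; apply: RealizedR_visser; right; right.
- by move=> S T _ IH G D fG fD sS sT; apply/GDPL_lift12/IH.
- move=> l Y Z S T _ IHY _ IHZ G D fG fD sS sT.
  have /realizedL_inv [A [B [eY eZ GBDA]]] :
    realizedL G D (MImp Y Z) by apply: sS; left.
  have sS' : S `<=` realizedL G D by move=> X SX; apply: sS; right.
  case: GBDA => [GB|DA].
    apply: IHZ => // X [->|/sS'//].
    by rewrite eZ; apply: RealizedL_visser.
  apply: IHY => // X [/sT//|->].
  by rewrite eY; apply: RealizedR_visser.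
- move=> l Y Z S T _ IH G D fG fD sS sT.
  have /realizedR_inv [A [B [eY eZ GA DB]]] :
    realizedR G D (MImp Y Z) by apply: sT; right.
  apply: IH => // X [].
  + by move=> ->; rewrite eY; apply: RealizedL_visser.
  + exact: sS.
  + by move=> TX; apply: sT; left.
  + by move=> ->; rewrite eZ; apply: RealizedR_visser.
- move=> X S _ IH G E fG fE sS sT.
  have /realizedR_box [A [B [EAB realAB]]] := sT _ erefl.
  (* All implications of G are principal, but they are also kept in Sigma: a
     box on the left in the premise is still realized by its implication. *)
  have [n [C [D [sCD CDP]]]] := finite_imps_enum fG.
  apply: (@GDPL_weak _ (G `|` [set PImp (C j) (D j) | j in [set: 'I_n]])
    [set PImp A B]) => // [X' []// /sCD//|_ ->//|].
  apply: GDPL_imp => i _.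
  set G' := (X in GDPL _ X _); set E' := (X in GDPL _ _ X).
  have fG' : finite_set G' by finite.
  have fE' : finite_set E' by finite.
  have GG' : G `<=` G' by move=> x Gx; left; right.
  have [realR realL] : realizedR G' E' X /\ realizedL G' E' (Box X).
    by apply: realAB; [right; right|right; left|left].
  have [ET|nET] := pselect (E' PTop); first exact: GDPL_top.
  apply: IH => // [Y|_ ->//].
  have boxL : forall Y, S Y -> realizedL G E (Box Y).
    by move=> Z SZ; apply: sS; exists Z.
  case=> [[[Z /boxL + <-]|/boxL/realizedL_box SY]|->//].
    case/realizedL_inv=> [[p -> [Gp|Gp]]|[F [H [-> GFH]]]].
    * exact/RealizedL_boxvar/GG'.
    * exact/RealizedL_boxtop/GG'.
    * exact/(RealizedL_visser _ (A := PImp F H))/GG'.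
  case: SY => [real|[F [H [/CDP [j -> ->]]]]]; first exact: real.
  apply; have [dj|dj] := boolP (digit i j).
    by left; left; left; exists j.
  by right; split=> //; right; exists j.
- move=> X S T _ IH G D fG fD sS sT.
  have sS' : S `<=` realizedL G D by move=> Y SY; apply: sS; right.
  have /realizedL_box [real|[A [B [GAB real]]]] : realizedL G D (Box X).
  + by apply: sS; left.
  + by apply: IH => // Y [->|/sS'//]; apply: real.
  rewrite -(absorbL GAB); apply: GDPL_impL.
    have fDA : finite_set (D `|` [set A]) by finite.
    have [DT|nDT] := pselect ((D `|` [set A]) PTop); first exact: GDPL_top.
    apply: IH => // [Y [->|/sS']|Y /sT].
    * by apply: real; right; split=> //; right.
    * exact: realizedL_setUr.
    * exact: realizedR_setUr.
  apply: IH => // [|Y [->|/sS']|Y /sT].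
  + finite.
  + by apply: real; left; left.
  + exact: realizedL_setUl.
  + exact: realizedR_setUl.
- move=> S T _ IH G E fG fE sS sT.
  (* What realizes boxed formulas consists of implications and, on the left,
     atoms; the rest of G and E comes back by weakening after the lift. *)
  have [n [A [B [sAB ABP]]]] := finite_imps_enum fG.
  have [m [C [D [sCD CDP]]]] := finite_imps_enum fE.
  set G' := [set PImp (A i) (B i) | i in [set: 'I_n]] `|` PVar @` [set p | G (PVar p)].
  have GG' : G' `<=` G by move=> _ [/sAB//|[p Gp <-]].
  have impG' F H : G (PImp F H) -> G' (PImp F H).
    by case/ABP=> j -> ->; left; exists j.
  apply: GDPL_weak (GDPL_lift23 (A := A) (B := B) (C := C) (D := D)
    (Phi := [set p | G (PVar p)]) _) => //.
  apply: IH => [|||].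
  + exact: sub_finite_set GG' fG.
  + finite.
  + move=> _ [X SX <-].
    have /realizedL_inv [[p -> [Gp|Gp]]|[F [H [-> GFH]]]] : realizedL G E (Box X).
    * by apply: sS; exists X.
    * by apply: RealizedL_boxvar; right; exists p.
    * exact/RealizedL_boxtop/impG'.
    * exact/(RealizedL_visser _ (A := PImp F H))/impG'.
  + move=> _ [X TX <-].
    have impE' F H : E (PImp F H) ->
        [set PImp (C j) (D j) | j in [set: 'I_m]] (PImp F H).
      by case/CDP=> j -> ->; exists j.
    have /realizedR_inv [[p -> Dp]|[F [H [-> DFH]]]] : realizedR G E (Box X).
    * by apply: sT; exists X.
    * exact/RealizedR_boxtop/impE'.
    * exact/(RealizedR_visser _ (A := PImp F H))/impE'.
Qed.

Theorem theorem8p10 (l : level) (Gamma Delta : set pform) :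
  GDPL l Gamma Delta <-> GD l (visser @` Gamma) (visser @` Delta).
Proof.
split; first exact: GDPL_GD.
move=> vGD; have [/finite_visser fG /finite_visser fD] := GD_finite vGD.
apply: (GD_GDPL_realized vGD) => // [_ [A GA <-]|_ [A DA <-]].
  exact: RealizedL_visser.
exact: RealizedR_visser.
Qed.
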